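(* Let $\Delta t>0$ and let $(\phi^n,\psi^n,u^n)_{n\ge 0}$ be a sequence produced by the S-SAV-CN scheme described in the context, i.e. $\phi^0\in H^6_{per}(\Omega)$, $\psi^0=0$, $u^0=\sqrt{\int_\Omega (F(\phi^0)+F_{vac}(\phi^0))\,dx+b}$, $(\phi^1,\psi^1,u^1)$ satisfies the first-step equations, and for every $n\ge 1$ $(\phi^{n+1},\psi^{n+1},u^{n+1})$ satisfies the S-SAV-CN equations. Then the scheme conserves mass: $$\int_\Omega \phi^{n+1}\,dx=\int_\Omega\phi^n\,dx=\cdots=\int_\Omega \phi^0\,dx\qquad\text{for all } n\ge 0 .$$
   Context: Let $d\in\{1,2,3\}$, $L>0$, $\Omega=[0,L]^d$ with periodic boundary conditions; $H^6_{per}(\Omega)$ is the space of real-valued periodic $H^6$ functions on $\Omega$. $\phi^n,\psi^n\in H^6_{per}(\Omega)$ and $u^n\in\mathbb{R}$. $(\cdot,\cdot)$ and $\|\cdot\|$ are the $L^2(\Omega)$ inner product and norm. Parameters: $M>0$; $\alpha,\beta\ge 0$ not both zero; $\epsilon\in(0,1)$; $h_{vac}\ge 0$; stabilization parameter $S>0$. Nonlinearities: $F(\phi)=\frac14\phi^4-\frac{\epsilon}{2}\phi^2$, $F_{vac}(\phi)=\frac{h_{vac}}{3}(|\phi|^3-\phi^3)$, $f(\phi)=F'(\phi)=\phi^3-\epsilon\phi$, $f_{vac}(\phi)=F_{vac}'(\phi)=h_{vac}(|\phi|-\phi)\phi$. $b$ is a constant such that $\int_\Omega (F(\phi)+F_{vac}(\phi))\,dx+b>0$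 for all $\phi$, and $$H(\phi)=\frac{f(\phi)+f_{vac}(\phi)}{\sqrt{\int_\Omega (F(\phi)+F_{vac}(\phi))\,dx+b}} .$$ Notation for a sequence $(g^n)$: $g^{n+1/2}=\frac{g^{n+1}+g^n}{2}$, $g^{\dagger,n+1}=\frac32 g^n-\frac12 g^{n-1}$, $g^{\star,n+1}=2g^n-g^{n-1}$. Write $H^{\dagger,n+1}=H(\phi^{\dagger,n+1})$ and $H^0=H(\phi^0)$. S-SAV-CN equations ($n\ge1$): $$\alpha\frac{\psi^{n+1}-\psi^n}{\Delta t}+\beta\psi^{n+1/2}=M\Delta\mu^{n+1/2},$$ $$\mu^{n+1/2}=(\Delta+1)^2\phi^{n+1/2}+H^{\dagger,n+1}u^{n+1/2}+S(\phi^{n+1}-\phi^{\star,n+1}),$$ $$\psi^{n+1/2}=\frac{\phi^{n+1}-\phi^n}{\Delta t},\qquad u^{n+1}-u^n=\frac12\int_\Omega H^{\dagger,n+1}(\phi^{n+1}-\phi^n)\,dx .$$ (Here $\mu^{n+1/2}$ is the function defined by the second equation.) First-step equations: $$\alpha\frac{\psi^1-\psi^0}{\Delta t}+\beta\psi^1=M\Delta\mu^1,\quad \mu^1=(\Delta+1)^2\phi^1+H^0u^1+S(\phi^1-\phi^0),$$ $$\psi^1=\frac{\phi^1-\phi^0}{\Delta t},\quad u^1-u^0=\frac12\int_\Omega H^0(\phi^1-\phi^0)\,dx .$$ *)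

(* Defs.v *)
From HB Require Import structures.
From mathcomp Require Import all_boot all_order all_algebra.
From mathcomp Require Import all_classical all_reals all_analysis.

Set Implicit Arguments.
Unset Strict Implicit.
Unset Printing Implicit Defensive.

Import Order.TTheory GRing.Theory Num.Theory.
Import numFieldNormedType.Exports.

Local Open Scope classical_set_scope.
Local Open Scope ring_scope.

Definition rV_display : measure_display.
Proof. exact: default_measure_display. Qed.

(* The Borel sigma-algebra of R^n, generated by the coordinates. *)
Section rV_measurable.
Context (R : realType) (n : nat).

Definition rV_coord (i : 'I_n) (x : 'rV[R]_n) : measurableTypeR R := x ord0 i.

Let rV_set0 : g_sigma_preimage rV_coord set0.
Proof. exact: sigma_algebra0. Qed.

Let rV_setC A : g_sigma_preimage rV_coord A -> g_sigma_preimage rV_coord (~` A).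
Proof. exact: sigma_algebraC. Qed.

Let rV_bigcup (F : (set 'rV[R]_n)^nat) :
  (forall i, g_sigma_preimage rV_coord (F i)) ->
  g_sigma_preimage rV_coord (\bigcup_i (F i)).
Proof. exact: sigma_algebra_bigcup. Qed.

HB.instance Definition _ := @isMeasurable.Build rV_display
  'rV[R]_n (g_sigma_preimage rV_coord) rV_set0 rV_setC rV_bigcup.

End rV_measurable.

Lemma measurable_rV_coord (R : realType) n (i : 'I_n) :
  measurable_fun [set: 'rV[R]_n] (@rV_coord R n i).
Proof.
move=> _ Y mY; rewrite setTI; apply: sub_sigma_algebra => /=.
rewrite -bigcup_seq/=; exists i => /=; first by rewrite mem_index_enum.
by exists Y => //; rewrite setTI.
Qed.

Lemma measurable_fun_rV d (T : measurableType d) (R : realType) n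
    (f : T -> 'rV[R]_n) :
  (forall i, measurable_fun [set: T] (rV_coord i \o f)) ->
  measurable_fun [set: T] f.
Proof.
move=> mf _ /= Y.
suff : measurable `<=` [set B | measurable (setT `&` f @^-1` B)] by apply.
apply: smallest_sub.
  split.
  - by rewrite /= preimage_set0 setI0.
  - move=> A /=; rewrite !setTI setTD => mA; rewrite -preimage_setC.
    exact: measurableC.
  - move=> F mF /=; rewrite setTI preimage_bigcup; apply: bigcupT_measurable.
    by move=> k; move: (mF k) => /=; rewrite setTI.
rewrite -bigcup_seq => A [i _ [B mB <-]] /=.
by rewrite setTI; exact: mf.
Qed.

Section rV_cons.
Context (R : realType) (n : nat).

Definition rV_cons (p : measurableTypeR R * 'rV[R]_n) : 'rV[R]_n.+1 :=
  row_mx (p.1 : R)%:M p.2.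

Lemma rV_cons0 p : rV_cons p ord0 ord0 = p.1.
Proof.
have e : ord0 = lshift n ord0 :> 'I_(1 + n) by exact/val_inj.
by rewrite /rV_cons [LHS](congr1 (row_mx _ _ ord0) e) row_mxEl mxE mulr1n.
Qed.

Lemma rV_consS p i : rV_cons p ord0 (lift ord0 i) = p.2 ord0 i.
Proof.
have e : lift ord0 i = rshift 1 i :> 'I_(1 + n) by exact/val_inj.
by rewrite /rV_cons [LHS](congr1 (row_mx _ _ ord0) e) row_mxEr.
Qed.

Lemma measurable_rV_cons : measurable_fun setT rV_cons.
Proof.
apply: measurable_fun_rV => i; case: (unliftP ord0 i) => [j ->|->].
  rewrite (_ : _ \o _ = @rV_coord R n j \o snd).
    by apply: measurableT_comp => //; exact: measurable_rV_coord.
  by apply/funext => p; rewrite /rV_coord /= rV_consS.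
rewrite (_ : _ \o _ = fst); first exact: measurable_fst.
by apply/funext => p; rewrite /rV_coord /= rV_cons0.
Qed.

Definition rV_uncons (x : 'rV[R]_n.+1) : measurableTypeR R * 'rV[R]_n :=
  (x ord0 ord0, \row_i x ord0 (lift ord0 i)).

Lemma rV_consK : cancel rV_cons rV_uncons.
Proof.
move=> [a x]; rewrite /rV_uncons rV_cons0; congr (_, _).
by apply/rowP => i; rewrite mxE rV_consS.
Qed.

Lemma measurable_rV_uncons : measurable_fun setT rV_uncons.
Proof.
apply: measurable_fun_pair; first exact: (@measurable_rV_coord R n.+1 ord0).
apply: measurable_fun_rV => i.
rewrite (_ : _ \o _ = @rV_coord R n.+1 (lift ord0 i)).
  exact: measurable_rV_coord.
by apply/funext => x; rewrite /rV_coord /= mxE.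
Qed.

End rV_cons.

Lemma measurable_rV_box (R : realType) n (A : 'I_n -> set R) :
  (forall i, measurable (A i)) ->
  measurable [set x : 'rV[R]_n | forall i, A i (x ord0 i)].
Proof.
move=> mA; rewrite (_ : [set _ | _] =
    \bigcap_(i in [set: 'I_n]) ([set: 'rV[R]_n] `&` rV_coord i @^-1` A i)).
  apply: fin_bigcap_measurable => // i _.
  by apply: (@measurable_rV_coord R n i) => //; exact: mA.
by apply/seteqP; split => x /= h i; [move=> _; split => //; exact: h|
  have [] := h i I].
Qed.

Section rV_prod.
Context (R : realType) (n : nat).
Variable mu : {sigma_finite_measure set 'rV[R]_n -> \bar R}.

Definition rV_prod : set 'rV[R]_n.+1 -> \bar R :=
  pushforward (@lebesgue_measure R \x mu)%E (@rV_cons R n).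

Let m_preimage (A : set 'rV[R]_n.+1) : measurable A ->
  measurable (@rV_cons R n @^-1` A).
Proof. by move=> mA; rewrite -[X in measurable X]setTI; exact: measurable_rV_cons. Qed.

Let rV_prod0 : rV_prod set0 = 0%E.
Proof. by rewrite /rV_prod /pushforward preimage_set0 measure0. Qed.

Let rV_prod_ge0 A : (0 <= rV_prod A)%E.
Proof. by rewrite /rV_prod /pushforward; exact: measure_ge0. Qed.

Let rV_prod_sigma_additive : semi_sigma_additive rV_prod.
Proof.
move=> F mF tF mUF; rewrite /rV_prod /pushforward preimage_bigcup.
apply: measure_semi_sigma_additive.
- by move=> k; exact: m_preimage.
- apply/trivIsetP => /= i j _ _ ij; rewrite -preimage_setI.
  by move/trivIsetP : tF => /(_ _ _ _ _ ij) ->//; rewrite preimage_set0.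
- by rewrite -preimage_bigcup; exact: m_preimage.
Qed.

HB.instance Definition _ := isMeasure.Build _ _ _ rV_prod
  rV_prod0 rV_prod_ge0 rV_prod_sigma_additive.

Lemma rV_prod_box (A : 'I_n.+1 -> set R) : (forall i, measurable (A i)) ->
  rV_prod [set x | forall i, A i (x ord0 i)] =
  (lebesgue_measure (A ord0) *
   mu [set x | forall i, A (lift ord0 i) (x ord0 i)])%E.
Proof.
move=> mA; rewrite -product_measure1E; [|exact: mA|
  by apply: (@measurable_rV_box R n (fun i => A (lift ord0 i))) => i; exact: mA].
rewrite /rV_prod /pushforward; congr (_ _); apply/seteqP; split => [p h|p [h0 h] i] /=.
  split=> [|i] /=; first by rewrite -rV_cons0; exact: h.
  by rewrite -rV_consS; exact: h.
by case: (unliftP ord0 i) => [j ->|->]; rewrite ?rV_consS ?rV_cons0//; exact: h.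
Qed.

Let rV_prod_sigma_finite : sigma_finite setT rV_prod.
Proof.
have /sigma_finiteP[F [FT ndF mF]] := sigma_finiteT (@lebesgue_measure R).
have /sigma_finiteP[G [GT ndG mG]] := sigma_finiteT mu.
exists (fun k => @rV_uncons R n @^-1` (F k `*` G k)).
  rewrite -preimage_bigcup (_ : \bigcup_i _ = setT) ?preimage_setT//.
  apply/seteqP; split => // -[a x] _.
  have [k _ Fka] : (\bigcup_k F k) a by rewrite -FT.
  have [l _ Glx] : (\bigcup_l G l) x by rewrite -GT.
  exists (maxn k l) => //; split => /=.
    by move: a Fka; exact/subsetPset/ndF/leq_maxl.
  by move: x Glx; exact/subsetPset/ndG/leq_maxr.
move=> k; have [[mFk Fk] [mGk Gk]] := (mF k, mG k); split.
  by rewrite -[X in measurable X]setTI; apply: measurable_rV_uncons => //;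
    exact: measurableX.
rewrite /rV_prod /pushforward -comp_preimage.
rewrite (_ : _ \o _ = id) ?preimage_id; last exact/funext/rV_consK.
by rewrite product_measure1E// lte_mul_pinfty// ge0_fin_numE.
Qed.

HB.instance Definition _ := Measure_isSigmaFinite.Build _ _ _ rV_prod
  rV_prod_sigma_finite.

End rV_prod.

(* Lebesgue measure on R^n, as an iterated product. *)
Fixpoint rV_lebesgue (R : realType) (n : nat) :
    {sigma_finite_measure set 'rV[R]_n -> \bar R} :=
  match n with
  | 0 => \d_(0 : 'rV[R]_0)
  | n'.+1 => rV_prod (rV_lebesgue R n')
  end.

Lemma rV_lebesgue_box (R : realType) n (A : 'I_n -> set R) :
  (forall i, measurable (A i)) ->
  rV_lebesgue R n [set x | forall i, A i (x ord0 i)] =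
  (\prod_(i < n) lebesgue_measure (A i))%E.
Proof.
elim: n A => [|n IH] A mA.
  by rewrite big_ord0 /= diracE mem_set// => -[].
rewrite big_ord_recl -(IH (fun i => A (lift ord0 i))) => [|i]; last exact: mA.
exact: rV_prod_box.
Qed.

Section periodic_sobolev.
Context (R : realType) (d : nat) (L : R).
Implicit Types (f g phi v : 'rV[R]_d -> R).

Definition cube : set 'rV[R]_d := [set x | forall i, x ord0 i \in `[0, L]].

Definition unit_vec (i : 'I_d) : 'rV[R]_d := delta_mx ord0 i.

Definition space_periodic f := forall i x, f (x + L *: unit_vec i) = f x.

(* Elements of L^2 are represented by everywhere periodic functions, and
   identities between them are stated almost everywhere on the cube; every
   class of L^2(cube) has such a representative. *)
Definition L2per f :=
  [/\ space_periodic f, measurable_fun cube f &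
      (rV_lebesgue R d).-integrable cube (fun x => (f x ^+ 2)%:E)].

Definition inner f g : R := \int[rV_lebesgue R d]_(x in cube) (f x * g x).

Definition eq_L2 f g := ae_eq (rV_lebesgue R d) cube f g.

(* A multi-index is given as the list of directions of differentiation. *)
Definition partials (s : seq 'I_d) v : 'rV[R]_d -> R :=
  foldr (fun i w => 'D_(unit_vec i) w) v s.

Definition smooth v := forall s : seq 'I_d,
  continuous (partials s v) /\
  forall i x, derivable (partials s v) x (unit_vec i).

Definition test_function v := smooth v /\ space_periodic v.

Definition weak_partial (s : seq 'I_d) f g :=
  [/\ L2per f, L2per g & forall v, test_function v ->
      inner g v = (-1) ^+ size s * inner f (partials s v)].

Definition Hper (k : nat) f :=
  L2per f /\
  forall s : seq 'I_d, (size s <= k)%N -> exists g, weak_partial s f g.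

Definition classical_laplacian v : 'rV[R]_d -> R :=
  fun x => \sum_(i < d) partials [:: i; i] v x.

(* g represents the (distributional, periodic) Laplacian of f. *)
Definition laplacian f g :=
  [/\ L2per f, L2per g & forall v, test_function v ->
      inner g v = inner f (classical_laplacian v)].

(* g represents (Delta + 1) f. *)
Definition laplacian1 f g := laplacian f (fun x => g x - f x).

(* g represents (Delta + 1)^2 f. *)
Definition laplacian1_sq f g := exists2 w, laplacian1 f w & laplacian1 w g.

End periodic_sobolev.
Arguments cube {R} d L.

Section time_grid.
Context (R : realType) (X : Type).
Implicit Types (g : nat -> X -> R) (n : nat).

(* g^{n+1/2} *)
Definition midpoint g n : X -> R := fun x => (g n.+1 x + g n x) / 2.

(* g^{dagger,n+1}; used for n >= 1 only *)
Definition extrap_half g n : X -> R :=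
  fun x => 3 / 2 * g n x - 1 / 2 * g n.-1 x.

(* g^{star,n+1}; used for n >= 1 only *)
Definition extrap_full g n : X -> R := fun x => 2 * g n x - g n.-1 x.

End time_grid.

Record model (R : realType) := Model {
  mobility : R;
  alpha : R;
  beta : R;
  eps : R;
  hvac : R;
  bshift : R;  (* the constant b under the square root *)
  stab : R    (* the stabilization parameter S *)
}.

Section scheme.
Context (R : realType) (d : nat) (L : R) (p : model R) (dt : R).
Implicit Types (phi psi : nat -> 'rV[R]_d -> R) (u : nat -> R).

Local Notation Omega := (cube d L).
Local Notation leb := (rV_lebesgue R d).

Definition Fbulk (r : R) : R := r ^+ 4 / 4 - eps p / 2 * r ^+ 2.
Definition Fvac (r : R) : R := hvac p / 3 * (`|r| ^+ 3 - r ^+ 3).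
Definition fbulk (r : R) : R := r ^+ 3 - eps p * r.
Definition fvac (r : R) : R := hvac p * (`|r| - r) * r.

Definition sav_energy (f : 'rV[R]_d -> R) : R :=
  \int[leb]_(x in Omega) (Fbulk (f x) + Fvac (f x)) + bshift p.

Definition Hsav (f : 'rV[R]_d -> R) : 'rV[R]_d -> R :=
  fun x => (fbulk (f x) + fvac (f x)) / Num.sqrt (sav_energy f).

(* In both steps, w stands for (Delta + 1)^2 phi and lmu for Delta mu. *)

Definition first_step phi psi u := exists w lmu,
  let mu x := w x + Hsav (phi 0%N) x * u 1%N + stab p * (phi 1%N x - phi 0%N x) in
  [/\ eq_L2 L (fun x => alpha p * ((psi 1%N x - psi 0%N x) / dt) + beta p * psi 1%N x)
              (fun x => mobility p * lmu x),
      laplacian L mu lmu,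
      laplacian1_sq L (phi 1%N) w,
      eq_L2 L (psi 1%N) (fun x => (phi 1%N x - phi 0%N x) / dt) &
      u 1%N - u 0%N =
        1 / 2 * \int[leb]_(x in Omega) (Hsav (phi 0%N) x * (phi 1%N x - phi 0%N x))].

Definition cn_step phi psi u (n : nat) := exists w lmu,
  let Hdag := Hsav (extrap_half phi n) in
  let mu x := w x + Hdag x * ((u n.+1 + u n) / 2) +
    stab p * (phi n.+1 x - extrap_full phi n x) in
  [/\ eq_L2 L (fun x => alpha p * ((psi n.+1 x - psi n x) / dt) +
                        beta p * midpoint psi n x)
              (fun x => mobility p * lmu x),
      laplacian L mu lmu,
      laplacian1_sq L (midpoint phi n) w,
      eq_L2 L (midpoint psi n) (fun x => (phi n.+1 x - phi n x) / dt) &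
      u n.+1 - u n =
        1 / 2 * \int[leb]_(x in Omega) (Hdag x * (phi n.+1 x - phi n x))].

Definition initialization phi psi u :=
  eq_L2 L (psi 0%N) (fun=> 0) /\ u 0%N = Num.sqrt (sav_energy (phi 0%N)).

(* (phi^n, psi^n, u^n) is produced by the S-SAV-CN scheme. *)
Definition ssav_cn phi psi u :=
  [/\ forall n, Hper L 6 (phi n) /\ Hper L 6 (psi n),
      initialization phi psi u,
      first_step phi psi u &
      forall n, (1 <= n)%N -> cn_step phi psi u n].

Definition admissible :=
  [/\ 0 < mobility p,
      0 <= alpha p /\ 0 <= beta p,
      ~ (alpha p = 0 /\ beta p = 0),
      0 < eps p < 1 &
      [/\ 0 <= hvac p, 0 < stab p &
          forall f : 'rV[R]_d -> R, Hper L 6 f -> 0 < sav_energy f]].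

End scheme.

(* Main.v *)
Require Import Defs.
From HB Require Import structures.
From mathcomp Require Import all_boot all_order all_algebra.
From mathcomp Require Import all_classical all_reals all_analysis.
From mathcomp Require Import ring lra.
Import Order.TTheory GRing.Theory Num.Theory.
Import numFieldNormedType.Exports.
Local Open Scope classical_set_scope.
Local Open Scope ring_scope.

(** Each step changes the integral of [phi] by [dt] times the integral of [psi]
    (at the new time level in the first step, at the midpoint afterwards), so
    it suffices that every [psi n] has integral zero.  Testing the
    [psi]-equation against the constant function 1, which is periodic and has
    zero Laplacian, kills its right-hand side whatever the chemical potential
    is ([integral_laplacian]).  What remains is a linear recurrence for the
    integrals [m n] of [psi n],
    [alpha * (m n.+1 - m n) / dt + beta * (m n.+1 + m n) / 2 = 0]
    (with [beta * m 1] as second term in the first step).  Its coefficient of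
    [m n.+1] is positive because [alpha] and [beta] are nonnegative and not
    both zero, and [m 0 = 0], hence all [m n] vanish ([integral_psi]).

    Since equations hold only almost everywhere between square-integrable
    functions, integrating them requires integrability; it holds because the
    cube has finite measure ([L2per_integrable]). *)

(** * Integration of linear combinations and of almost-everywhere equations *)

Section linear_integrals.
Context {dsp : measure_display} {T : measurableType dsp} {R : realType}.
Variables (mu : {measure set T -> \bar R}) (D : set T).
Hypothesis mD : measurable D.

Lemma integrable_scale (a : R) (f : T -> R) :
  mu.-integrable D (EFin \o f) -> mu.-integrable D (EFin \o (fun x => a * f x)).
Proof.
have -> : EFin \o (fun x => a * f x) = (fun x => a%:E * (EFin \o f) x)%E.
  by apply/funext => x /=; rewrite EFinM.
exact: integrableZl.
Qed.

Lemma integrable_lincomb (a b : R) (f g : T -> R) :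
  mu.-integrable D (EFin \o f) -> mu.-integrable D (EFin \o g) ->
  mu.-integrable D (EFin \o (fun x => a * f x + b * g x)).
Proof.
move=> /(integrable_scale a) intf /(integrable_scale b) intg.
exact: (integrableD mD intf intg).
Qed.

Lemma Rintegral_lincomb (a b : R) (f g : T -> R) :
  mu.-integrable D (EFin \o f) -> mu.-integrable D (EFin \o g) ->
  \int[mu]_(x in D) (a * f x + b * g x) =
  a * \int[mu]_(x in D) f x + b * \int[mu]_(x in D) g x.
Proof.
by move=> intf intg; rewrite RintegralD ?RintegralZl//; exact: integrable_scale.
Qed.

Lemma ae_eq_Rintegral (f g : T -> R) :
  mu.-integrable D (EFin \o f) -> mu.-integrable D (EFin \o g) ->
  ae_eq mu D f g -> \int[mu]_(x in D) f x = \int[mu]_(x in D) g x.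
Proof.
move=> intf intg fg; rewrite /Rintegral; congr fine.
apply: ae_eq_integral => //.
- exact: measurable_int intf.
- exact: measurable_int intg.
- by apply: filterS fg => x /= fgx Dx; rewrite fgx.
Qed.

(** On a set of finite measure [L^2] is contained in [L^1], by
    [`|f| <= 1 + f ^+ 2]. *)
Lemma integrable_sqr (f : T -> R) : (mu D < +oo)%E -> measurable_fun D f ->
  mu.-integrable D (fun x => (f x ^+ 2)%:E) -> mu.-integrable D (EFin \o f).
Proof.
move=> muD mf intf2.
have int1 : mu.-integrable D (cst 1%E).
  apply/integrableP; split; first exact: measurable_cst.
  under eq_integral do rewrite /= normr1.
  by rewrite integral_cst// mul1e.
apply: (le_integrable mD _ _ (integrableD mD int1 intf2)).
  by apply/measurable_realfun.measurable_EFinP.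
move=> x _ /=; rewrite lee_fin [leRHS]ger0_norm; last first.
  by rewrite addr_ge0// sqr_ge0.
rewrite -real_normK ?num_real//.
by have := sqr_ge0 (`|f x| - 1); have := normr_ge0 (f x); nra.
Qed.

End linear_integrals.

(** * Periodic functions on the cube *)

Section cube_integrals.
Context {R : realType} {d : nat} (L : R).
Local Notation Omega := (cube d L).
Local Notation leb := (rV_lebesgue R d).
Local Notation total f := (\int[leb]_(x in Omega) f x).

Lemma measurable_cube : measurable Omega.
Proof. by apply: (@measurable_rV_box R d (fun=> [set` `[0, L]])) => i. Qed.

Lemma cube_finite : (leb Omega < +oo)%E.
Proof.
have -> : leb Omega = (\prod_(i < d) lebesgue_measure [set` `[0%R, L]])%E.
  by apply: (@rV_lebesgue_box R d (fun=> [set` `[0, L]])) => i.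
rewrite -[X in (X < _)%E]fineK ?ltry//.
apply: (big_ind (fun z => z \is a fin_num)) => // [x y|i _].
  exact: fin_numM.
by rewrite lebesgue_measure_itv /=; case: ifP.
Qed.

Lemma L2per_integrable (f : 'rV[R]_d -> R) :
  L2per L f -> leb.-integrable Omega (EFin \o f).
Proof.
case=> _ mf intf2; apply: integrable_sqr => //; first exact: measurable_cube.
exact: cube_finite.
Qed.

Lemma partials_cst (i : 'I_d) (s : seq 'I_d) (c : R) :
  partials (i :: s) (cst c : 'rV[R]_d -> R) = cst 0.
Proof.
elim: s i => [|j s IH] i; apply/funext => x; first exact: derive_cst.
transitivity ('D_(unit_vec R i) (partials (j :: s) (cst c)) x) => //.
by rewrite IH derive_cst.
Qed.

Lemma test_function_cst (c : R) : test_function L (cst c : 'rV[R]_d -> R).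
Proof.
split=> [s|//].
have [c' ->] : exists c', partials s (cst c : 'rV[R]_d -> R) = cst c'.
  by case: s => [|i s]; [exists c | exists 0; exact: partials_cst].
by split=> [x|i x]; [exact: cst_continuous | exact: derivable_cst].
Qed.

(** The divergence theorem on the torus, which for the distributional
    Laplacian is the choice of 1 as a test function. *)
Lemma integral_laplacian (f g : 'rV[R]_d -> R) :
  laplacian L f g -> total g = 0.
Proof.
case=> _ _ /(_ _ (test_function_cst 1)).
have -> : classical_laplacian (cst 1 : 'rV[R]_d -> R) = cst 0.
  apply/funext => x; rewrite /classical_laplacian big1// => i _.
  by rewrite partials_cst.
rewrite /inner; under eq_Rintegral do rewrite mulr1.
move=> ->; under eq_Rintegral do rewrite mulr0.
by rewrite /Rintegral integral0.
Qed.

(** The first-step and Crank-Nicolson equations for [psi] differ only in the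
    coefficients [a] and [b] of the new iterate [g] and the old iterate [f], so
    one integrated form serves for both. *)
Lemma integral_lincomb_eq0 (a b c : R) (f g nu lnu : 'rV[R]_d -> R) :
  L2per L f -> L2per L g -> laplacian L nu lnu ->
  eq_L2 L (fun x => a * g x + b * f x) (fun x => c * lnu x) ->
  a * total g + b * total f = 0.
Proof.
move=> /L2per_integrable intf /L2per_integrable intg lap.
have intl : leb.-integrable Omega (EFin \o lnu).
  by case: lap => _ /L2per_integrable.
have mO := measurable_cube.
have clE : (fun x => c * lnu x) = (fun x => c * lnu x + 0 * lnu x).
  by apply/funext => x; rewrite mul0r addr0.
rewrite clE => /ae_eq_Rintegral; rewrite !Rintegral_lincomb// => -> //.
- by rewrite (integral_laplacian _ _ lap) !mulr0 addr0.
- exact: integrable_lincomb.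
- exact: integrable_lincomb.
Qed.

End cube_integrals.

(** * Mass conservation *)

Section mass.
Context {R : realType} {d : nat} (L : R) (p : model R) (dt : R).
Context (phi psi : nat -> 'rV[R]_d -> R) (u : nat -> R).
Hypotheses (hp : admissible d L p) (hdt : 0 < dt).
Hypothesis hscheme : ssav_cn L p dt phi psi u.
Local Notation leb := (rV_lebesgue R d).
Local Notation total f := (\int[leb]_(x in cube d L) f x).

Let L2phi n : L2per L (phi n).
Proof. by case: hscheme => /(_ n)[[]]. Qed.

Let L2psi n : L2per L (psi n).
Proof. by case: hscheme => /(_ n)[_ []]. Qed.

Let intphi n := L2per_integrable L _ (L2phi n).
Let intpsi n := L2per_integrable L _ (L2psi n).

Lemma leading_coef_gt0 (c : R) : 0 < c -> 0 < alpha p / dt + beta p * c.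
Proof.
move=> c0; case: hp => _ [a0 b0] ab _ _.
have adt0 : 0 <= alpha p / dt by rewrite divr_ge0// ltW.
have bc0 : 0 <= beta p * c by rewrite mulr_ge0// ltW.
rewrite lt0r addr_ge0// andbT paddr_eq0// !mulf_eq0 invr_eq0.
rewrite (gt_eqF hdt) (gt_eqF c0) !orbF.
by apply/negP => /andP[/eqP a /eqP b]; exact: ab.
Qed.

Lemma integral_psi n : total (psi n) = 0.
Proof.
have [_ [psi0 _] [w [lmu [eqpsi lap _ _ _]]] step] := hscheme.
have mO := @measurable_cube R d L.
have psi0E : total (psi 0%N) = 0.
  rewrite (ae_eq_Rintegral _ _ mO _ _ (intpsi 0) _ psi0).
    by rewrite /Rintegral integral0.
  exact: integrable0.
elim: n => [//|[_|n IH]].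
  have E : (fun x => alpha p * ((psi 1%N x - psi 0%N x) / dt)
                     + beta p * psi 1%N x) =
      (fun x => (alpha p / dt + beta p * 1) * psi 1%N x
                + (- (alpha p / dt)) * psi 0%N x).
    by apply/funext => x; ring.
  rewrite E in eqpsi.
  have := integral_lincomb_eq0 L _ _ _ _ _ _ _ (L2psi 0) (L2psi 1) lap eqpsi.
  rewrite psi0E mulr0 addr0 => /eqP.
  by rewrite mulf_eq0 (gt_eqF (leading_coef_gt0 _ ltr01)) => /eqP.
have {eqpsi lap w lmu} [w [lmu [eqpsi lap _ _ _]]] := step n.+1 isT.
have half0 : 0 < 2^-1 :> R by rewrite invr_gt0.
have E : (fun x => alpha p * ((psi n.+2 x - psi n.+1 x) / dt)
                   + beta p * midpoint psi n.+1 x) =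
    (fun x => (alpha p / dt + beta p * 2^-1) * psi n.+2 x
              + (- (alpha p / dt) + beta p * 2^-1) * psi n.+1 x).
  by apply/funext => x; rewrite /midpoint; ring.
rewrite E in eqpsi.
have := integral_lincomb_eq0 L _ _ _ _ _ _ _ (L2psi n.+1) (L2psi n.+2) lap eqpsi.
rewrite IH mulr0 addr0 => /eqP.
by rewrite mulf_eq0 (gt_eqF (leading_coef_gt0 _ half0)) => /eqP.
Qed.

Lemma integral_phiS n : total (phi n.+1) = total (phi n).
Proof.
have mO := @measurable_cube R d L.
(* A combination of [psi n.+1] and [psi n] covers both kinds of steps. *)
have [a [b eqphi]] : exists a b, eq_L2 L
    (fun x => a * psi n.+1 x + b * psi n x)
    (fun x => dt^-1 * phi n.+1 x + (- dt^-1) * phi n x).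
  have diffE m : (fun x => (phi m.+1 x - phi m x) / dt) =
      (fun x => dt^-1 * phi m.+1 x + (- dt^-1) * phi m x).
    by apply/funext => x; ring.
  have [_ _ [w [lmu [_ _ _ eq1 _]]] step] := hscheme.
  case: n => [|n].
    exists 1, 0; rewrite -diffE.
    have -> : (fun x => 1 * psi 1%N x + 0 * psi 0%N x) = psi 1%N.
      by apply/funext => x; ring.
    exact: eq1.
  have [_ [_ [_ _ _ eqn _]]] := step n.+1 isT.
  exists 2^-1, 2^-1; rewrite -diffE.
  have -> : (fun x => 2^-1 * psi n.+2 x + 2^-1 * psi n.+1 x)
      = midpoint psi n.+1.
    by apply/funext => x; rewrite /midpoint; ring.
  exact: eqn.
have := ae_eq_Rintegral _ _ mO _ _ (integrable_lincomb _ _ mO _ _ _ _ (intpsi _) (intpsi _))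
  (integrable_lincomb _ _ mO _ _ _ _ (intphi _) (intphi _)) eqphi.
rewrite !Rintegral_lincomb// !integral_psi !mulr0 addr0 mulNr -mulrBr.
move=> /esym/eqP; rewrite mulf_eq0 invr_eq0 (gt_eqF hdt) subr_eq0.
by move=> /eqP.
Qed.

End mass.

Theorem theorem3p1 (R : realType) (d : nat) (hd : (1 <= d <= 3)%N)
    (L : R) (hL : 0 < L) (p : model R) (hp : admissible d L p)
    (dt : R) (hdt : 0 < dt)
    (phi psi : nat -> 'rV[R]_d -> R) (u : nat -> R)
    (hscheme : ssav_cn L p dt phi psi u) :
  forall n : nat,
    \int[rV_lebesgue R d]_(x in cube d L) phi n.+1 x =
      \int[rV_lebesgue R d]_(x in cube d L) phi n x /\
    \int[rV_lebesgue R d]_(x in cube d L) phi n x =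
      \int[rV_lebesgue R d]_(x in cube d L) phi 0%N x.
Proof.
have step := integral_phiS L p dt phi psi u hp hdt hscheme.
move=> n; split; first exact: step.
by elim: n => [//|n IH]; rewrite step.
Qed.
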